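(* Let $(A,A_r^* )$ be a factorizable Zinbiel bialgebra with $I=r_+-r_-$, and let $\lambda\in\mathbb{K}$. Then $(A,\circ_A,P,\omega_I)$ is a quadratic Rota-Baxter Zinbiel algebra of weight $\lambda$, where the linear map $P:A\to A$ and $\omega_I\in\wedge^2A^*$ are defined by $P=\lambda\, r_-\circ I^{-1}$ and $\omega_I(x,y)=\langle I^{-1}x,y\rangle$ for all $x,y\in A$.
   Context: All vector spaces are finite-dimensional over a field $\mathbb{K}$ of characteristic different from $2$. A Zinbiel algebra $(A,\circ_A)$ is a vector space with a bilinear product satisfying $x\circ_A(y\circ_A z)=(x\circ_A y+y\circ_A x)\circ_A z$. Write $x\ast_A y=x\circ_A y+y\circ_A x$, $L_x(y)=x\circ_A y$, $R_x(y)=y\circ_A x$, $\langle L_x^*\xi,y\rangle=-\langle\xi,x\circ_A y\rangle$, $\langle R_x^*\xi,y\rangle=-\langle\xi,y\circ_A x\rangle$ ($\xi\in A^*$). For $r=\sum_i a_i\otimes b_i\in A\otimes A$ define $r_\pm:A^*\to A$ by $\langle r_+(\xi),\eta\rangle=r(\xi,\eta)=\langle\xi,r_-(\eta)\rangle$, put $I=r_+-r_-:A^*\to A$, let $a$ be the skew-symmetric part of $r$, and let $$[\![r,r]\!]=\sum_{i,j}\big(-a_i\circ_A a_j\otimes b_j\otimes b_i-b_j\otimes a_i\circ_A a_j\otimes b_i+a_i\ast_A b_j\otimes a_j\otimes b_i+a_i\otimes b_i\ast_A a_j\otimes b_j-a_i\otimes a_j\otimes b_i\ast_A b_j\big).$$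 An element $s\in A\otimes A$ is $(L,L+R)$-invariant if $(L_x\otimes\mathrm{Id}-\mathrm{Id}\otimes(L_x+R_x))s=0$ for all $x\in A$. If $[\![r,r]\!]=0$ and $a$ is $(L,L+R)$-invariant, then $\alpha(x)=(\mathrm{Id}\otimes(L_x+R_x)-L_x\otimes\mathrm{Id})r$ makes $(A,A^* )$ a Zinbiel bialgebra with product $\xi\cdot_r\eta=-(L^*_{r_+(\xi)}+R^*_{r_+(\xi)})\eta+R^*_{r_-(\eta)}\xi$ on $A^*$ (denoted $A_r^*$); this $(A,A_r^* )$ is called the quasi-triangular Zinbiel bialgebra induced by $r$. It is called factorizable if $a$ is nondegenerate, i.e. if $I:A^*\to A$ is a linear isomorphism. (A Zinbiel bialgebra is a pair of Zinbiel algebra structures on $A$ and $A^*$, dual to maps $\beta:A^*\to A^*\otimes A^*$ and $\alpha:A\to A\otimes A$ respectively, with $\alpha(x\ast_A y)=(L_x\otimes\mathrm{Id})\alpha(y)+(\mathrm{Id}\otimes(L_y+R_y))\alpha(x)$ and $\beta(\xi\ast_{A^*}\eta)=(\mathcal{L}_\xi\otimes\mathrm{Id})\beta(\eta)+(\mathrm{Id}\otimes(\mathcal{L}_\eta+\mathcal{R}_\eta))\beta(\xi)$, where $\mathcal{L},\mathcal{R}$ are left and right multiplications of $A^*$ and $\xi\ast_{A^*}\eta$ is the symmetrized product of $A^*$.) A quadratic Rota-Baxter Zinbiel algebra of weight $\lambda$ is a quadruple $(A,\circ_A,P,\omega)$ where $(A,\circ_A)$ is a Zinbiel algebra; $P:A\to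 A$ is linear with $P(x)\circ_A P(y)=P(P(x)\circ_A y+x\circ_A P(y)+\lambda x\circ_A y)$; $\omega$ is a nondegenerate skew-symmetric bilinear form with $\omega(x\circ_A y,z)=\omega(y,x\circ_A z+z\circ_A x)$; and $\omega(Px,y)+\omega(x,Py)+\lambda\omega(x,y)=0$, for all $x,y,z\in A$. *)

(* Defs.v *)
From HB Require Import structures.
From mathcomp Require Import all_boot all_order all_algebra.
From mathcomp Require Import ring.
Set Implicit Arguments.
Unset Strict Implicit.
Unset Printing Implicit Defensive.
Import GRing.Theory.
Local Open Scope ring_scope.

Definition bilinear_map (K : fieldType) (U V W : vectType K)
    (f : U -> V -> W) : Prop :=
  (forall v, linear (f^~ v)) /\ (forall u, linear (f u)).

(** The dual space; the pairing <xi, x> is the application [xi x]. *)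
Notation dual A := 'Hom(A, _^o) (only parsing).

(** ** Tensor products

    MathComp has no tensor product of vector spaces.  [tensor U V] is the space
    of coordinate arrays with respect to the bases [vbasis {:U}] and
    [vbasis {:V}].  Coordinates only serve to define [pure] and [tlift]; these
    satisfy the universal property ([tlift_pure], [tlift_uniq]), and everything
    else is expressed through them. *)
Definition tensor (K : fieldType) (U V : vectType K) :=
  'M[K]_(\dim {:U}, \dim {:V}).

Definition pure (K : fieldType) (U V : vectType K) (u : U) (v : V) : tensor U V :=
  \matrix_(i, j) (coord (vbasis {:U}) i u * coord (vbasis {:V}) j v).

(** The linear map out of [tensor U V] induced by a bilinear map [f], that is
    [sum_i u_i (x) v_i |-> sum_i f u_i v_i]. *)
Definition tlift (K : fieldType) (U V W : vectType K) (f : U -> V -> W)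
    (t : tensor U V) : W :=
  \sum_i \sum_j t i j *: f (vbasis {:U})`_i (vbasis {:V})`_j.

Notation "u \ox v" := (pure u v)
  (at level 38, right associativity, format "u  \ox  v") : ring_scope.

Section TensorOps.
Variable K : fieldType.
Implicit Types U V : vectType K.

Definition tform U V (f : U -> V -> K) (t : tensor U V) : K :=
  tlift (W := K^o) f t.

Definition tmap U V U' V' (f : U -> U') (g : V -> V') : tensor U V -> tensor U' V' :=
  tlift (fun u v => f u \ox g v).

Definition tflip U V : tensor U V -> tensor V U := tlift (fun u v => v \ox u).

(** The pairing of [xi (x) eta] with [t], i.e. [t(xi, eta)]. *)
Definition teval U V (xi : dual U) (eta : dual V) (t : tensor U V) : K :=
  tform (fun u v => (xi u : K) * eta v) t.

Definition skew_part U (r : tensor U U) : tensor U U :=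
  2^-1 *: (r - tflip r).

(** The defining pairings of [rplus] and [rminus] are the lemmas [rplus_pairing]
    and [rminus_pairing]. *)
Definition rplus U (r : tensor U U) : 'Hom(dual U, U) :=
  linfun (fun xi : dual U => tlift (fun a b => (xi a : K) *: b) r).

Definition rminus U (r : tensor U U) : 'Hom(dual U, U) :=
  linfun (fun eta : dual U => tlift (fun a b => (eta b : K) *: a) r).

Definition Imap U (r : tensor U U) : 'Hom(dual U, U) := rplus r - rminus r.

End TensorOps.

Section Zinbiel.
Variables (K : fieldType) (A : vectType K).
Implicit Types (mul : A -> A -> A) (r : tensor A A).

Record zinbiel (V : vectType K) (mul : V -> V -> V) : Prop := Zinbiel {
  zinbiel_bilinear : bilinear_map mul;
  zinbiel_axiom : forall x y z,
    mul x (mul y z) = mul (mul x y + mul y x) z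
}.

(** The symmetrized product; [symprod mul x] is the operator [L_x + R_x]. *)
Definition symprod (V : vectType K) (mul : V -> V -> V) (x y : V) : V :=
  mul x y + mul y x.

Definition Lstar mul (x : A) (xi : dual A) : dual A :=
  linfun (fun y => - xi (mul x y)).

Definition Rstar mul (x : A) (xi : dual A) : dual A :=
  linfun (fun y => - xi (mul y x)).

Definition zinbiel_bracket mul r : tensor A (tensor A A) :=
  tlift (fun ai bi => tlift (fun aj bj =>
    - (mul ai aj \ox bj \ox bi)
    - (bj \ox mul ai aj \ox bi)
    + (symprod mul ai bj \ox aj \ox bi)
    + (ai \ox symprod mul bi aj \ox bj)
    - (ai \ox aj \ox symprod mul bi bj)) r) r.

Definition LLR_invariant mul (s : tensor A A) : Prop :=
  forall x, tmap (mul x) id s - tmap id (symprod mul x) s = 0.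

(** The map [alpha] and the product of [A_r^*]. *)
Definition rcoproduct mul r (x : A) : tensor A A :=
  tmap id (symprod mul x) r - tmap (mul x) id r.

Definition rproduct mul r (xi eta : dual A) : dual A :=
  - (Lstar mul (rplus r xi) eta + Rstar mul (rplus r xi) eta)
  + Rstar mul (rminus r eta) xi.

(** [alpha] and [beta] are dual to the products of [A^*] and [A]. *)
Record zinbiel_bialgebra mul (dmul : dual A -> dual A -> dual A)
    (alpha : A -> tensor A A) (beta : dual A -> tensor (dual A) (dual A)) : Prop :=
  ZinbielBialgebra {
  bialgebra_zinbiel : zinbiel mul;
  bialgebra_zinbiel_dual : zinbiel dmul;
  bialgebra_alphaE : forall x (xi eta : dual A),
    teval xi eta (alpha x) = dmul xi eta x;
  bialgebra_betaE : forall (xi : dual A) x y,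
    tform (fun eta zeta : dual A => (eta x : K) * zeta y) (beta xi)
    = xi (mul x y);
  bialgebra_alpha : forall x y,
    alpha (symprod mul x y)
    = tmap (mul x) id (alpha y) + tmap id (symprod mul y) (alpha x);
  bialgebra_beta : forall xi eta,
    beta (symprod dmul xi eta)
    = tmap (dmul xi) id (beta eta) + tmap id (symprod dmul eta) (beta xi)
}.

(** The conditions under which [A] and [A_r^*] form the quasi-triangular Zinbiel
    bialgebra induced by [r].  That they do form a Zinbiel bialgebra is the
    lemma [quasi_triangular_bialgebra] below. *)
Record quasi_triangular mul r : Prop := QuasiTriangular {
  quasi_triangular_zinbiel : zinbiel mul;
  quasi_triangular_bracket : zinbiel_bracket mul r = 0;
  quasi_triangular_invariant : LLR_invariant mul (skew_part r)
}.

Definition factorizable mul r : Prop :=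
  quasi_triangular mul r /\ bijective (Imap r).

Record quadratic_rota_baxter_zinbiel mul (lambda : K) (P : 'End(A))
    (omega : A -> A -> K) : Prop := QuadraticRotaBaxterZinbiel {
  qrb_zinbiel : zinbiel mul;
  qrb_rota_baxter : forall x y,
    mul (P x) (P y) = P (mul (P x) y + mul x (P y) + lambda *: mul x y);
  qrb_bilinear : bilinear_map (W := K^o) omega;
  qrb_skew : forall x y, omega x y = - omega y x;
  qrb_nondegenerate : forall x, (forall y, omega x y = 0) -> x = 0;
  qrb_invariant : forall x y z,
    omega (mul x y) z = omega y (symprod mul x z);
  qrb_compatible : forall x y,
    omega (P x) y + omega x (P y) + lambda * omega x y = 0
}.

(** [(Imap r)^-1] is the inverse map of [Imap r] when the latter is bijective. *)
Definition omegaI r (x y : A) : K := ((Imap r)^-1)%VF x y.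

End Zinbiel.

Section Arith.
Variable K : fieldType.

Fact arith1 (a b c d e f g h k : K) :
  a - b = - c - - d + (- e - - f) ->
  - d - b + (c + e) + (g + a) + (- h - k) = 0 -> k + h - g = f.
Proof.
move=> H1 H2; apply/eqP; rewrite -subr_eq0; apply/eqP.
transitivity (- (- d - b + (c + e) + (g + a) + (- h - k))
  + ((a - b) - (- c - - d + (- e - - f)))); first by ring.
by rewrite H1 H2 subrr oppr0 addr0.
Qed.

Fact arith2 (k a b c d : K) :
  k * a + b - (k * c + d) = k * (a - c) + (b - d).
Proof. by ring. Qed.

Fact arith3 (s a b c d e f g : K) :
  a - b = - c - - d + (- e - - f) ->
  s - g - f = s + (- g - a - - d + (- e - c - - b)).
Proof.
move=> H; apply/eqP; rewrite -subr_eq0; apply/eqP.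
transitivity ((a - b) - (- c - - d + (- e - - f))); first by ring.
by rewrite H subrr.
Qed.

Fact arith4 (s t a b c d e f : K) :
  a - b = - c - - d + (- e - - f) ->
  t + a - d + (e + c - b) = t + s + (f - s).
Proof.
move=> H; apply/eqP; rewrite -subr_eq0; apply/eqP.
transitivity ((a - b) - (- c - - d + (- e - - f))); first by ring.
by rewrite H subrr.
Qed.

End Arith.

Section TensorTheory.
Variable K : fieldType.
Implicit Types U V W : vectType K.

Lemma linear_sumE U V (f : U -> V) (I : finType) (c : I -> K) (x : I -> U) :
  linear f -> f (\sum_i c i *: x i) = \sum_i c i *: f (x i).
Proof.
move=> lf.
have fD u v : f (u + v) = f u + f v by have := lf 1 u v; rewrite !scale1r.
have f0 : f 0 = 0 by apply: (addIr (f 0)); rewrite -fD !add0r.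
have fZ a u : f (a *: u) = a *: f u.
  by have := lf a u 0; rewrite addr0 f0 addr0.
rewrite (big_morph f fD f0); apply: eq_bigr => i _; exact: fZ.
Qed.

Lemma vbasis_coord U (u : U) :
  u = \sum_i coord (vbasis {:U}) i u *: (vbasis {:U})`_i.
Proof. exact: (coord_vbasis (memvf u)). Qed.

Lemma tlift_linear U V W (f : U -> V -> W) : linear (tlift f).
Proof.
move=> a t t'; rewrite /tlift scaler_sumr -big_split; apply: eq_bigr => i _.
rewrite scaler_sumr -big_split; apply: eq_bigr => j _.
by rewrite !mxE /= scalerDl scalerA.
Qed.

Lemma eq_tlift U V W (f g : U -> V -> W) (t : tensor U V) :
  (forall u v, f u v = g u v) -> tlift f t = tlift g t.
Proof.
by move=> fg; apply: eq_bigr => i _; apply: eq_bigr => j _; rewrite fg.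
Qed.

Lemma tlift_pure U V W (f : U -> V -> W) u v :
  bilinear_map f -> tlift f (u \ox v) = f u v.
Proof.
move=> [fl fr]; rewrite [in RHS](vbasis_coord u) (linear_sumE _ _ (fl v)).
apply: eq_bigr => i _; rewrite [in RHS](vbasis_coord v) (linear_sumE _ _ (fr _)).
by rewrite scaler_sumr; apply: eq_bigr => j _; rewrite mxE scalerA.
Qed.

Lemma linear_tlift U V W W' (g : W -> W') (f : U -> V -> W) (t : tensor U V) :
  linear g -> g (tlift f t) = tlift (fun u v => g (f u v)) t.
Proof.
move=> lg; rewrite /tlift.
have -> : \sum_i \sum_j t i j *: f (vbasis {:U})`_i (vbasis {:V})`_j
   = \sum_i (1 : K) *: \sum_j t i j *: f (vbasis {:U})`_i (vbasis {:V})`_j.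
  by apply: eq_bigr => i _; rewrite scale1r.
rewrite linear_sumE //; apply: eq_bigr => i _.
by rewrite scale1r linear_sumE.
Qed.

Lemma pure_bilinear U V : bilinear_map (@pure K U V).
Proof.
by split=> [v a u u' | u a v v']; apply/matrixP=> i j; rewrite !mxE linearP /=
  ?mulrDl ?mulrDr ?mulrA // [_ * a]mulrC.
Qed.

Lemma tlift_id U V (t : tensor U V) : tlift (@pure K U V) t = t.
Proof.
apply/matrixP=> k l.
have -> : tlift (@pure K U V) t k l =
    \sum_i \sum_j t i j * (((i == k)%:R : K) * (j == l)%:R).
  etransitivity; first exact: summxE.
  apply: eq_bigr => i _; etransitivity; first exact: summxE.
  by apply: eq_bigr => j _; rewrite !mxE !coord_free ?(basis_free (vbasisP _)).
rewrite (bigD1 k) //= [X in _ + X]big1 ?addr0; last first.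
  by move=> i /negPf neq; rewrite big1 // => j _; rewrite neq mul0r mulr0.
rewrite (bigD1 l) //= [X in _ + X]big1 ?addr0; last first.
  by move=> j /negPf neq; rewrite neq !mulr0.
by rewrite !eqxx !mulr1.
Qed.

Lemma tlift_uniq U V W (g : tensor U V -> W) :
  linear g -> forall t, g t = tlift (fun u v => g (u \ox v)) t.
Proof. by move=> lg t; rewrite -[in LHS](tlift_id t) linear_tlift. Qed.

Lemma tlift_sum U V W (f : U -> V -> W) (n : nat) (a : 'I_n -> U) (b : 'I_n -> V) :
  bilinear_map f -> tlift f (\sum_i a i \ox b i) = \sum_i f (a i) (b i).
Proof.
move=> bf; have -> : \sum_i a i \ox b i = \sum_i (1 : K) *: (a i \ox b i).
  by apply: eq_bigr => i _; rewrite scale1r.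
rewrite linear_sumE; last exact: tlift_linear.
by apply: eq_bigr => i _; rewrite scale1r tlift_pure.
Qed.

Lemma linear_addf U V (f g : U -> V) :
  linear f -> linear g -> linear (fun u => f u + g u).
Proof. by move=> lf lg k u v; rewrite lf lg scalerDr addrACA. Qed.

Lemma linear_oppf U V (f : U -> V) : linear f -> linear (fun u => - f u).
Proof. by move=> lf k u v; rewrite lf opprD scalerN. Qed.

Lemma tliftD U V W (f g : U -> V -> W) t :
  tlift (fun u v => f u v + g u v) t = tlift f t + tlift g t.
Proof.
rewrite /tlift -big_split; apply: eq_bigr => i _.
by rewrite -big_split; apply: eq_bigr => j _; rewrite scalerDr.
Qed.

Lemma tliftN U V W (f : U -> V -> W) t :
  tlift (fun u v => - f u v) t = - tlift f t.
Proof.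
rewrite /tlift raddf_sum; apply: eq_bigr => i _.
by rewrite raddf_sum; apply: eq_bigr => j _; rewrite scalerN.
Qed.

Lemma tliftZ U V W (k : K) (f : U -> V -> W) t :
  tlift (fun u v => k *: f u v) t = k *: tlift f t.
Proof.
rewrite /tlift scaler_sumr; apply: eq_bigr => i _.
by rewrite scaler_sumr; apply: eq_bigr => j _; rewrite !scalerA mulrC.
Qed.

Lemma tformE U V (f : U -> V -> K) (t : tensor U V) :
  tform f t = \sum_i \sum_j t i j * f (vbasis {:U})`_i (vbasis {:V})`_j.
Proof. by []. Qed.

Lemma eq_tform U V (f g : U -> V -> K) (t : tensor U V) :
  (forall u v, f u v = g u v) -> tform f t = tform g t.
Proof. exact: (@eq_tlift U V K^o). Qed.

Lemma tformD U V (f g : U -> V -> K) t :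
  tform (fun u v => f u v + g u v) t = tform f t + tform g t.
Proof. exact: (@tliftD U V K^o). Qed.

Lemma tformN U V (f : U -> V -> K) t :
  tform (fun u v => - f u v) t = - tform f t.
Proof. exact: (@tliftN U V K^o). Qed.

Lemma tform_linear U V (f : U -> V -> K) :
  linear (fun t : tensor U V => tform f t : K^o).
Proof. exact: (@tlift_linear U V K^o). Qed.

Lemma tform_pure U V (f : U -> V -> K) u v :
  bilinear_map (W := K^o) f -> tform f (u \ox v) = f u v.
Proof. exact: (@tlift_pure U V K^o). Qed.

Lemma tform_tlift U V W (g : W -> K) (f : U -> V -> W) (t : tensor U V) :
  linear (g : W -> K^o) -> g (tlift f t) = tform (fun u v => g (f u v)) t.
Proof. exact: (@linear_tlift U V W K^o). Qed.

Lemma scalar_linearP V (g : V -> K) : linear (g : V -> K^o) ->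
  [/\ {morph g : u v / u + v}, {morph g : u / - u}, g 0 = 0 &
      forall k u, g (k *: u) = k * g u].
Proof.
move=> lg.
have gD : {morph g : u v / u + v} by move=> u v; have := lg 1 u v; rewrite !scale1r.
have g0 : g 0 = 0 by apply: (addIr (g 0)); rewrite -gD !add0r.
have gZ k u : g (k *: u) = k * g u by have := lg k u 0; rewrite !addr0 g0 addr0.
by split=> // u; rewrite -scaleN1r gZ mulN1r.
Qed.

End TensorTheory.
Section BialgebraProof.
Variables (K : fieldType) (A : vectType K).

Lemma lfun_linear (U V : vectType K) (f : 'Hom(U, V)) : linear f.
Proof. by move=> a u v; rewrite linearP. Qed.

Lemma linfunE (U V : vectType K) (f : U -> V) :
  linear f -> forall x, linfun f x = f x.
Proof.
move=> lf x.
pose F : {linear U -> V} := HB.pack f (GRing.isLinear.Build _ _ _ _ f lf).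
exact: (lfunE F).
Qed.

Lemma rplusE (r : tensor A A) (xi : dual A) :
  rplus r xi = tlift (fun a b => (xi a : K) *: b) r.
Proof.
apply: linfunE => k u v; rewrite -tliftZ -tliftD; apply: eq_tlift => a b.
by rewrite !lfunE /= lfunE /= scalerDl scalerA.
Qed.

Lemma rminusE (r : tensor A A) (eta : dual A) :
  rminus r eta = tlift (fun a b => (eta b : K) *: a) r.
Proof.
apply: linfunE => k u v; rewrite -tliftZ -tliftD; apply: eq_tlift => a b.
by rewrite !lfunE /= lfunE /= scalerDl scalerA.
Qed.

Lemma dual_linear (U : vectType K) (xi : dual U) : linear (xi : U -> K^o).
Proof. exact: lfun_linear. Qed.

Lemma tform_rminus (r : tensor A A) (g : A -> K) (eta : dual A) :
  linear (g : A -> K^o) ->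
  tform (fun a b => g a * eta b) r = g (rminus r eta).
Proof.
move=> lg; rewrite rminusE tform_tlift //; apply: (@eq_tform K) => a b.
by have [_ _ _ ->] := scalar_linearP lg; rewrite mulrC.
Qed.

Lemma tform_rplus (r : tensor A A) (g : A -> K) (xi : dual A) :
  linear (g : A -> K^o) ->
  tform (fun a b => (xi a : K) * g b) r = g (rplus r xi).
Proof.
move=> lg; rewrite rplusE tform_tlift //; apply: (@eq_tform K) => a b.
by have [_ _ _ ->] := scalar_linearP lg.
Qed.

Lemma rplus_pairing (r : tensor A A) (xi eta : dual A) :
  eta (rplus r xi) = teval xi eta r.
Proof. by rewrite -(@tform_rplus r eta) //; apply: dual_linear. Qed.

Lemma rminus_pairing (r : tensor A A) (xi eta : dual A) :
  xi (rminus r eta) = teval xi eta r.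
Proof. by rewrite -(@tform_rminus r xi) //; apply: dual_linear. Qed.

Definition dual_coord (i : 'I_(\dim {:A})) : dual A := linfun (coord (vbasis {:A}) i : A -> K^o).

Lemma dual_coordE i x : dual_coord i x = coord (vbasis {:A}) i x.
Proof. by apply: linfunE => a u v; rewrite linearP. Qed.

Lemma dual_sep (x y : A) : (forall xi : dual A, xi x = xi y) -> x = y.
Proof.
move=> eqxy; rewrite (vbasis_coord x) (vbasis_coord y); apply: eq_bigr => i _.
by rewrite -!dual_coordE eqxy.
Qed.

Lemma dual_decomp (xi : dual A) :
  xi = \sum_(i < \dim {:A}) (xi (vbasis {:A})`_i : K) *: dual_coord i.
Proof.
apply/lfunP=> x; rewrite {1}(vbasis_coord x) (linear_sumE _ _ (lfun_linear xi)).
rewrite sum_lfunE; apply: eq_bigr => i _.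
by rewrite lfunE /= dual_coordE; apply: mulrC.
Qed.

Definition deval (x y : A) (t : tensor (dual A) (dual A)) : K :=
  tform (fun eta zeta : dual A => (eta x : K) * zeta y) t.

Lemma deval_inj t t' : (forall x y, deval x y t = deval x y t') -> t = t'.
Proof.
suff E s : s = \sum_(i < \dim {:A}) \sum_(j < \dim {:A}) deval (vbasis {:A})`_i (vbasis {:A})`_j s *:
    (dual_coord i \ox dual_coord j).
  move=> eqt; rewrite (E t) (E t'); apply: eq_bigr => i _.
  by apply: eq_bigr => j _; rewrite eqt.
rewrite -[LHS]tlift_id.
transitivity (tlift (fun e f : dual A => \sum_(i < \dim {:A}) \sum_(j < \dim {:A})
   ((e (vbasis {:A})`_i : K) * f (vbasis {:A})`_j) *:
    (dual_coord i \ox dual_coord j)) s).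
  apply: eq_tlift => e f; have [pl pr] := pure_bilinear (dual A) (dual A).
  rewrite {1}(dual_decomp e) (linear_sumE _ _ (pl f)).
  apply: eq_bigr => i _; rewrite {1}(dual_decomp f) (linear_sumE _ _ (pr _)).
  by rewrite scaler_sumr; apply: eq_bigr => j _; rewrite scalerA.
rewrite {1}/tlift.
under eq_bigr => k _ do under eq_bigr => l _ do
  (rewrite scaler_sumr; under eq_bigr => i _ do rewrite scaler_sumr).
under eq_bigr => k _ do rewrite exchange_big.
rewrite exchange_big; apply: eq_bigr => i _ /=.
under eq_bigr => k _ do rewrite exchange_big.
rewrite exchange_big; apply: eq_bigr => j _ /=.
rewrite /deval tformE scaler_suml; apply: eq_bigr => k _.
by rewrite scaler_suml; apply: eq_bigr => l _; rewrite scalerA.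
Qed.

Section Product.
Variable mul : A -> A -> A.
Hypothesis bmul : bilinear_map mul.

Lemma bmulDl x y z : mul (x + y) z = mul x z + mul y z.
Proof. by have := bmul.1 z 1 x y; rewrite !scale1r. Qed.
Lemma bmulDr x y z : mul x (y + z) = mul x y + mul x z.
Proof. by have := bmul.2 x 1 y z; rewrite !scale1r. Qed.
Lemma bmul0l z : mul 0 z = 0.
Proof. by apply: (addIr (mul 0 z)); rewrite -bmulDl !add0r. Qed.
Lemma bmul0r z : mul z 0 = 0.
Proof. by apply: (addIr (mul z 0)); rewrite -bmulDr !add0r. Qed.
Lemma bmulZl k x z : mul (k *: x) z = k *: mul x z.
Proof. by have := bmul.1 z k x 0; rewrite !addr0 bmul0l addr0. Qed.
Lemma bmulZr k x z : mul z (k *: x) = k *: mul z x.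
Proof. by have := bmul.2 z k x 0; rewrite !addr0 bmul0r addr0. Qed.
Lemma bmulNl x z : mul (- x) z = - mul x z.
Proof. by rewrite -scaleN1r bmulZl scaleN1r. Qed.
Lemma bmulNr x z : mul z (- x) = - mul z x.
Proof. by rewrite -scaleN1r bmulZr scaleN1r. Qed.

Lemma LstarE x (xi : dual A) y : Lstar mul x xi y = - xi (mul x y).
Proof.
by apply: linfunE => k u v; rewrite bmulDr bmulZr linearP /= opprD scalerN.
Qed.

Lemma RstarE x (xi : dual A) y : Rstar mul x xi y = - xi (mul y x).
Proof.
by apply: linfunE => k u v; rewrite bmulDl bmulZl linearP /= opprD scalerN.
Qed.

Lemma symprod_bilinear : bilinear_map (symprod mul).
Proof.
by split=> [v k x y | v k x y]; rewrite /symprod !(bmulDl, bmulDr, bmulZl, bmulZr)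
  scalerDr addrACA.
Qed.

(** [zinbiel_bracket] does not depend on the decomposition of [r]. *)
Lemma zinbiel_bracket_sum (n : nat) (a b : 'I_n -> A) :
  zinbiel_bracket mul (\sum_i a i \ox b i) =
  \sum_i \sum_j (
    - (mul (a i) (a j) \ox b j \ox b i)
    - (b j \ox mul (a i) (a j) \ox b i)
    + (symprod mul (a i) (b j) \ox a j \ox b i)
    + (a i \ox symprod mul (b i) (a j) \ox b j)
    - (a i \ox a j \ox symprod mul (b i) (b j))).
Proof.
have [pl pr] := pure_bilinear A A.
have [ql qr] := pure_bilinear A (tensor A A).
have [bl br] := bmul; have [sl sr] := symprod_bilinear.
pose F (x y z t : A) : tensor A (tensor A A) :=
  - (mul x z \ox t \ox y) - (t \ox mul x z \ox y)
  + (symprod mul x t \ox z \ox y) + (x \ox symprod mul y z \ox t)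
  - (x \ox z \ox symprod mul y t).
have F1 y z t : linear (fun x => F x y z t).
  rewrite /F; repeat first [refine (linear_addf _ _) | refine (linear_oppf _)];
  by move=> k u v; rewrite ?bl ?sl ?pl ?pr ?ql ?qr.
have F2 x z t : linear (fun y => F x y z t).
  rewrite /F; repeat first [refine (linear_addf _ _) | refine (linear_oppf _)];
  by move=> k u v; rewrite ?bl ?sl ?pl ?pr ?ql ?qr.
have F3 x y t : linear (fun z => F x y z t).
  rewrite /F; repeat first [refine (linear_addf _ _) | refine (linear_oppf _)];
  by move=> k u v; rewrite ?br ?sr ?pl ?pr ?ql ?qr.
have F4 x y z : linear (fun t => F x y z t).
  rewrite /F; repeat first [refine (linear_addf _ _) | refine (linear_oppf _)];
  by move=> k u v; rewrite ?br ?sr ?pl ?pr ?ql ?qr.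
rewrite /zinbiel_bracket tlift_sum; last first.
  split=> [y k x x'|x k y y']; rewrite -tliftZ -tliftD; apply: eq_tlift => z t.
    exact: (F1 y z t).
  exact: (F2 x z t).
apply: eq_bigr => i _; rewrite tlift_sum //.
by split=> [t|z]; [exact: (F3 (a i) (b i) t)|exact: (F4 (a i) (b i) z)].
Qed.
End Product.

Section QuasiTriangular.
Hypothesis charK : 2%N \notin [pchar K].
Variables (mul : A -> A -> A) (r : tensor A A).
Hypothesis qt : quasi_triangular mul r.

Let bm : bilinear_map mul := zinbiel_bilinear (quasi_triangular_zinbiel qt).
Let zin := zinbiel_axiom (quasi_triangular_zinbiel qt).
Let mDl := bmulDl bm.
Let mDr := bmulDr bm.
Let mZl := bmulZl bm.
Let mZr := bmulZr bm.
Let mNl := bmulNl bm.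
Let mNr := bmulNr bm.
Let bpure := pure_bilinear A A.

Local Notation "x ** y" := (mul x y) (at level 40, left associativity).
Local Notation "x <*> y" := (symprod mul x y) (at level 40, left associativity).
Local Notation p := (rplus r).
Local Notation m := (rminus r).
Local Notation I := (Imap r).
Local Notation dmul := (rproduct mul r).

Let IE xi : I xi = p xi - m xi.
Proof. by rewrite !lfunE /= !lfunE. Qed.

Let flip (xi eta : dual A) : eta (p xi) = xi (m eta).
Proof. by rewrite rplus_pairing rminus_pairing. Qed.

Let Iskew (xi eta : dual A) : eta (I xi) = - xi (I eta).
Proof. by rewrite !IE !linearB /= !flip opprK addrC. Qed.

Let teval_linear (xi eta : dual A) : linear (fun t => teval xi eta t : K^o).
Proof. exact: tform_linear. Qed.

Let tevalB xi eta (t t' : tensor A A) :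
  teval xi eta (t - t') = teval xi eta t - teval xi eta t'.
Proof. by have [D N _ _] := scalar_linearP (teval_linear xi eta); rewrite D N. Qed.

Let tevalZ xi eta k (t : tensor A A) : teval xi eta (k *: t) = k * teval xi eta t.
Proof. by have [_ _ _ ->] := scalar_linearP (teval_linear xi eta). Qed.

Let teval0 xi eta : teval xi eta (0 : tensor A A) = 0.
Proof. by have [_ _ -> _] := scalar_linearP (teval_linear xi eta). Qed.

Let teval_pure (xi eta : dual A) (u v : A) :
  teval xi eta (u \ox v) = xi u * eta v.
Proof.
rewrite /teval tform_pure //; split=> [w k x y|w k x y].
  have [-> _ _ ->] := scalar_linearP (dual_linear xi).
  by rewrite /GRing.scale /=; ring.
have [-> _ _ ->] := scalar_linearP (dual_linear eta).
by rewrite /GRing.scale /=; ring.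
Qed.

Let teval_tmap (xi eta : dual A) (f g : A -> A) t :
  teval xi eta (tmap f g t) = tform (fun u v => (xi (f u) : K) * eta (g v)) t.
Proof.
rewrite /tmap (tform_tlift _ _ (teval_linear xi eta)).
by apply: (@eq_tform K) => u v; rewrite teval_pure.
Qed.

Let inv2 : 2 != 0 :> K.
Proof. by apply: contraNneq charK => /eqP; rewrite inE /= => ->. Qed.

Let Iteval (xi eta : dual A) : eta (I xi) = 2 * teval xi eta (skew_part r).
Proof.
rewrite IE linearB /= rplus_pairing rminus_pairing tevalZ mulrA divff // mul1r.
rewrite tevalB; congr (_ - _).
rewrite /tflip (tform_tlift _ _ (teval_linear xi eta)).
by rewrite {1}/teval; apply: (@eq_tform K) => u v; rewrite teval_pure mulrC.
Qed.

Let Mstar x (xi : dual A) : dual A := Lstar mul x xi + Rstar mul x xi.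

Let MstarE x xi y : Mstar x xi y = - xi (x <*> y).
Proof. by rewrite lfunE /= LstarE // RstarE // -opprD -linearD. Qed.

Let I_Lstar x xi : I (Lstar mul x xi) = - (x <*> I xi).
Proof.
apply: dual_sep => eta; rewrite linearN /= -MstarE !Iteval; congr (_ * _).
have /(congr1 (teval xi eta)) := quasi_triangular_invariant qt x.
rewrite tevalB !teval_tmap teval0 => /subr0_eq E.
transitivity (- tform (fun u v : A => (xi (mul x u) : K) * eta v) (skew_part r)).
  by rewrite -tformN {1}/teval; apply: (@eq_tform K) => u v; rewrite LstarE // mulNr.
by rewrite E -tformN /teval; apply: (@eq_tform K) => u v; rewrite MstarE // mulrN.
Qed.

Let inv1 (xi eta : dual A) x : eta (x ** I xi) = - xi (x <*> I eta).
Proof.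
have := Iskew xi (Lstar mul x eta).
by rewrite LstarE // I_Lstar linearN /= opprK => /eqP; rewrite eqr_oppLR => /eqP.
Qed.

Let symC x y : x <*> y = y <*> x.
Proof. by rewrite /symprod addrC. Qed.

Let zinA x y z : x ** (y ** z) = (x <*> y) ** z.
Proof. exact: zin. Qed.

Let zinAC x y z : x ** (y ** z) = y ** (x ** z).
Proof. by rewrite !zinA symC. Qed.

Let symA x y z : x <*> (y <*> z) = (x <*> y) <*> z.
Proof.
have E a b c : (a <*> b) <*> c = a ** (b ** c) + c ** (a ** b) + c ** (b ** a).
  by rewrite [LHS]/symprod -zinA [in c ** _]/symprod mDr addrA.
by rewrite symC !E (zinAC y z x) (zinAC x z y) -addrA addrC.
Qed.

Let eval3 (a b c : dual A) (t : tensor A (tensor A A)) : K :=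
  tform (fun u t' => (a u : K) * teval b c t') t.

Let eval3_linear a b c : linear (fun t => eval3 a b c t : K^o).
Proof. exact: tform_linear. Qed.

Let eval3_pure a b c u v w : eval3 a b c (u \ox v \ox w) = a u * (b v * c w).
Proof.
rewrite /eval3 tform_pure ?teval_pure //; split=> [t k x y|x k t t'].
  have [-> _ _ ->] := scalar_linearP (dual_linear a).
  by rewrite /GRing.scale /=; ring.
have [-> _ _ ->] := scalar_linearP (teval_linear b c).
by rewrite /GRing.scale /=; ring.
Qed.

Let linM (f : A -> A) (k : K) (xi : dual A) : linear f ->
  linear (fun a => (xi (f a) : K) * k : K^o).
Proof.
move=> lf c u v; rewrite lf; have [-> _ _ ->] := scalar_linearP (dual_linear xi).
by rewrite /GRing.scale /=; ring.
Qed.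

Let linM' (f : A -> A) (k : K) (xi : dual A) : linear f ->
  linear (fun a => k * xi (f a) : K^o).
Proof.
move=> lf c u v; rewrite lf; have [-> _ _ ->] := scalar_linearP (dual_linear xi).
by rewrite /GRing.scale /=; ring.
Qed.

Let lin1 (f : A -> A) (xi : dual A) : linear f ->
  linear (fun a => xi (f a) : K^o).
Proof. by move=> lf c u v; rewrite lf linearP. Qed.

Let bracket_eval (z x e : dual A) :
  - z (m e ** m x) - x (m e ** m z) + z (m e <*> p x) + x (p z <*> m e)
  - e (p z <*> p x) = 0 :> K.
Proof.
have /(congr1 (eval3 z x e)) := quasi_triangular_bracket qt.
have [eD eN e0 _] := scalar_linearP (eval3_linear z x e).
rewrite e0 /zinbiel_bracket (tform_tlift _ _ (eval3_linear z x e)) => <-.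
have [sl sr] := symprod_bilinear bm; have [bl br] := bm.
transitivity (tform (fun ai bi : A =>
    - ((z (ai ** m x) : K) * e bi) - (x (ai ** m z) : K) * e bi
    + (z (ai <*> p x) : K) * e bi + (z ai : K) * x (bi <*> m e)
    - (z ai : K) * e (bi <*> p x)) r).
  rewrite !tformD !tformN.
  rewrite (@tform_rminus r (fun a => z (a ** m x)) e (lin1 z (bl _))).
  rewrite (@tform_rminus r (fun a => x (a ** m z)) e (lin1 x (bl _))).
  rewrite (@tform_rminus r (fun a => z (a <*> p x)) e (lin1 z (sl _))).
  rewrite (@tform_rplus r (fun a => x (a <*> m e)) z (lin1 x (sl _))).
  by rewrite (@tform_rplus r (fun a => e (a <*> p x)) z (lin1 e (sl _))).
apply: (@eq_tform K) => a b; rewrite (tform_tlift _ _ (eval3_linear z x e)).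
transitivity (tform (fun c d : A =>
    - ((z (a ** c) : K) * e b * x d) - (x (a ** c) : K) * e b * z d
    + (x c : K) * ((z (a <*> d) : K) * e b) + (z a : K) * x (b <*> c) * e d
    - (x c : K) * ((z a : K) * e (b <*> d))) r).
  rewrite !tformD !tformN.
  rewrite (@tform_rminus r (fun c => (z (a ** c) : K) * e b) x (linM _ z (br _))).
  rewrite (@tform_rminus r (fun c => (x (a ** c) : K) * e b) z (linM _ x (br _))).
  rewrite (@tform_rplus r (fun c => (z (a <*> c) : K) * e b) x (linM _ z (sr _))).
  rewrite (@tform_rminus r (fun c => (z a : K) * x (b <*> c)) e (linM' _ x (sr _))).
  by rewrite (@tform_rplus r (fun c => (z a : K) * e (b <*> c)) x (linM' _ e (sr _))).
apply: (@eq_tform K) => c d; rewrite !eD !eN !eval3_pure; ring.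
Qed.

Let pE xi : p xi = m xi + I xi.
Proof. by rewrite IE addrC subrK. Qed.

Let rprodE xi eta x : dmul xi eta x = eta (p xi <*> x) - xi (x ** m eta).
Proof.
rewrite /rproduct add_lfunE opp_lfunE RstarE // -/(Mstar (p xi) eta) MstarE.
by rewrite opprK.
Qed.

Let m_hom xi eta : m (dmul xi eta) = m xi ** m eta.
Proof.
apply: dual_sep => z; rewrite -flip rprodE.
have := bracket_eval z xi eta; have := inv1 z xi (m eta).
rewrite !IE mDr mNr /symprod mDr mDl mNr mNl !linearD !linearN /=.
set a := xi _; set b := xi _; set c := z _; set d := z _; set e := z _.
set f := z _; set g := xi _; set h := eta _; set k := eta _; exact: arith1.
Qed.

Let I_Mstar x xi : I (Mstar x xi) = - (x ** I xi).
Proof.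
by apply: dual_sep => eta; rewrite linearN /= Iskew MstarE inv1.
Qed.

Let RstarM x xi : Rstar mul x xi = Mstar x xi - Lstar mul x xi.
Proof. by rewrite /Mstar addrC addKr. Qed.

Let I_dmul xi eta : I (dmul xi eta) = p xi ** I eta + I xi ** m eta.
Proof.
rewrite /rproduct -/(Mstar (p xi) eta) RstarM linearD linearB linearN /=.
by rewrite !I_Mstar I_Lstar !opprK /symprod addKr.
Qed.

Let p_hom xi eta : p (dmul xi eta) = p xi ** p eta.
Proof. by rewrite pE m_hom I_dmul addrCA -mDl -pE addrC -mDr -pE. Qed.

Let lfun_comb k (f g : dual A) u : (k *: f + g) u = k * f u + g u.
Proof. by rewrite add_lfunE scale_lfunE. Qed.

Let rproduct_bilinear : bilinear_map dmul.
Proof.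
split=> [v k x y|v k x y]; apply/lfunP=> u.
  rewrite rprodE 2!lfun_comb !rprodE.
  rewrite linearP /= (symprod_bilinear bm).1 linearP /= /GRing.scale /=.
  by apply: arith2.
rewrite rprodE 2!lfun_comb !rprodE.
rewrite linearP /= bm.2 linearP /= /GRing.scale /=.
by apply: arith2.
Qed.

Let rproduct_zinbiel : zinbiel dmul.
Proof.
split; first exact: rproduct_bilinear.
move=> xi eta zeta; apply/lfunP=> x; rewrite !rprodE add_lfunE !rprodE m_hom.
rewrite [p (_ + _)]linearD /= !p_hom -/(symprod mul (p xi) (p eta)) symA (symC (p eta)).
rewrite -zinA (zinAC x); move: (x ** m zeta) => w.
move: (zeta _) => s; have := inv1 xi eta w; rewrite !IE mDr mNr /symprod mDr mDl mNr mNl !linearD !linearN /=.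
exact: arith3.
Qed.

Let tmap_comp (f f' g g' : A -> A) (t : tensor A A) : linear f -> linear g ->
  tmap f g (tmap f' g' t) = tmap (f \o f') (g \o g') t.
Proof.
move=> lf lg; rewrite /tmap linear_tlift; last exact: tlift_linear.
apply: (@eq_tlift K) => u v; rewrite tlift_pure //.
have [pl pr] := bpure.
by split=> [w k x y|w k x y]; rewrite ?lf ?lg ?pl ?pr.
Qed.

Let eq_tmap (f f' g g' : A -> A) (t : tensor A A) : f =1 f' -> g =1 g' ->
  tmap f g t = tmap f' g' t.
Proof. by move=> ff gg; apply: (@eq_tlift K) => u v; rewrite ff gg. Qed.

Let tmapB (f g : A -> A) (t t' : tensor A A) :
  tmap f g (t - t') = tmap f g t - tmap f g t'.
Proof.
by rewrite [t - t']addrC -scaleN1r [LHS](@tlift_linear K) scaleN1r addrC.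
Qed.

Let linid : linear (@id A). Proof. by []. Qed.

Let rcoproduct_compat x y : rcoproduct mul r (x <*> y)
  = tmap (mul x) id (rcoproduct mul r y)
    + tmap id (symprod mul y) (rcoproduct mul r x).
Proof.
rewrite /rcoproduct !tmapB.
have lx := bm.2 x; have ly := (symprod_bilinear bm).2 y.
rewrite !tmap_comp //.
have -> : tmap (id \o mul x) (symprod mul y \o id) r
   = tmap (mul x \o id) (id \o symprod mul y) r by exact: eq_tmap.
rewrite [RHS]addrC subrKA; congr (_ - _).
  by apply: eq_tmap => // u /=; rewrite symA (symC y x).
by apply: eq_tmap => // u /=; rewrite zinA.
Qed.

Let rcoproductE x (xi eta : dual A) :
  teval xi eta (rcoproduct mul r x) = dmul xi eta x.
Proof.
rewrite rprodE tevalB !teval_tmap.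
rewrite (@tform_rplus r (fun v => eta (x <*> v)) xi); last first.
  by apply: lin1; exact: (symprod_bilinear bm).2.
rewrite (@tform_rminus r (fun v => xi (x ** v)) eta); last first.
  by apply: lin1; exact: bm.2.
by rewrite symC.
Qed.

Let beta (xi : dual A) : tensor (dual A) (dual A) :=
  \sum_(i < \dim {:A}) \sum_(j < \dim {:A})
    (xi ((vbasis {:A})`_i ** (vbasis {:A})`_j) : K) *: (dual_coord i \ox dual_coord j).

Let deval_linear x y : linear (fun t => deval x y t : K^o).
Proof. exact: tform_linear. Qed.

Let dual_evalB (x y : A) :
  bilinear_map (W := K^o) (fun e f : dual A => (e x : K) * f y).
Proof.
by split=> [f k e e'|e k f f']; rewrite lfun_comb /GRing.scale /=; ring.
Qed.

Let betaE (xi : dual A) x y : deval x y (beta xi) = xi (x ** y).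
Proof.
have [dD _ d0 dZ] := scalar_linearP (deval_linear x y).
rewrite /beta (big_morph _ dD d0) {2}(vbasis_coord x).
rewrite (linear_sumE _ _ (bm.1 y)) (linear_sumE _ _ (dual_linear xi)).
apply: eq_bigr => i _; rewrite (big_morph _ dD d0) {2}(vbasis_coord y).
rewrite (linear_sumE _ _ (bm.2 _)) (linear_sumE _ _ (dual_linear xi)) scaler_sumr.
apply: eq_bigr => j _; rewrite dZ /deval tform_pure; last exact: dual_evalB.
by rewrite !dual_coordE mulrC -mulrA.
Qed.

Let deval_tmap x y (f g : dual A -> dual A) t :
  deval x y (tmap f g t) = tform (fun e h => (f e x : K) * g h y) t.
Proof.
rewrite /tmap (tform_tlift _ _ (deval_linear x y)).
by apply: (@eq_tform K) => e h; rewrite /deval tform_pure //; exact: dual_evalB.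
Qed.

Let dmul_left xi eta x :
  dmul xi eta x = eta (p xi <*> x + p (Lstar mul x xi)).
Proof.
by rewrite rprodE [RHS]linearD /= flip LstarE.
Qed.

Let dmul_right xi eta x :
  dmul eta xi x = eta (- m (Mstar x xi) - x ** m xi).
Proof.
rewrite rprodE [RHS]linearB /=; congr (_ - _).
by rewrite [RHS]linearN /= -flip MstarE opprK symC.
Qed.

Let beta_compat xi eta :
  beta (symprod dmul xi eta)
    = tmap (dmul xi) id (beta eta) + tmap id (symprod dmul eta) (beta xi).
Proof.
apply: deval_inj => x y.
have [dD _ _ _] := scalar_linearP (deval_linear x y).
rewrite dD !deval_tmap betaE.
pose X := p xi <*> x + p (Lstar mul x xi).
pose Y := p eta <*> y + p (Lstar mul y eta) + (- m (Mstar y eta) - y ** m eta).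
have -> : tform (fun e h : dual A => (dmul xi e x : K) * h y) (beta eta)
    = eta (X ** y).
  by rewrite -betaE; apply: (@eq_tform K) => e h; rewrite dmul_left.
have -> : tform (fun e h : dual A => (e x : K) * symprod dmul eta h y) (beta xi)
    = xi (x ** Y).
  rewrite -betaE; apply: (@eq_tform K) => e h.
  by rewrite /symprod add_lfunE dmul_left dmul_right -linearD.
have {Y} -> : Y = m eta ** y - m (Rstar mul y eta).
  have bs := symprod_bilinear bm.
  have E : p (Lstar mul y eta)
      = m (Lstar mul y eta) - (y <*> p eta - y <*> m eta).
    by rewrite pE I_Lstar IE (bmulDr bs) (bmulNr bs).
  rewrite /Y E [m (Mstar _ _)]linearD /= [p eta <*> y]symC {E Y}.
  move: (m _) (m (Rstar _ _ _)) (y <*> p eta) => b e a.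
  rewrite opprB [b + _]addrA [a + _]addrC subrK [y <*> _]addrC opprD -!addrA.
  rewrite [y ** _ + _]addrCA [y ** _ + _]addrC subrK.
  by rewrite [m eta ** y + _]addrCA addNKr.
have -> : eta (X ** y) = eta (p xi ** (x ** y)) + xi (x ** m (Rstar mul y eta)).
  rewrite /X mDl linearD /= zinA; congr (_ + _).
  by rewrite -[LHS]opprK -RstarE // flip LstarE // opprK.
rewrite (bmulDr bm) (bmulNr bm) linearB /= add_lfunE !rprodE.
rewrite [in RHS](zinAC x); move: (x ** y) => w.
move: (xi (x ** _)) => s.
have := inv1 xi eta w; rewrite !IE mDr mNr /symprod mDr mDl mNr mNl !linearD !linearN /=.
exact: arith4.
Qed.

Lemma quasi_triangular_bialgebra :
  exists beta, zinbiel_bialgebra mul (rproduct mul r) (rcoproduct mul r) beta.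
Proof.
by exists beta; split.
Qed.

End QuasiTriangular.
End BialgebraProof.

(* Main.v *)
(** Write [o] for the product of [A], [*] for its symmetrization and [.] for the
    product of [A_r^*].  Invariance of the skew part of [r] amounts to
    [eta (x o I xi) = - xi (x * I eta)], which is the invariance of [omega_I]
    read through [I]; it also gives
    [I (xi . eta) = r_+ xi o I eta + I xi o r_- eta].  Together with the
    vanishing of the bracket it yields [r_- (xi . eta) = r_- xi o r_- eta].
    Since [r_+ = r_- + I], the first formula turns [lambda^2] times the second
    one into the Rota-Baxter identity at [I xi], [I eta]. *)
Require Import Defs.
From mathcomp Require Import all_boot all_order all_algebra.
From mathcomp Require Import ring.
Import GRing.Theory.
Local Open Scope ring_scope.

Lemma linear_scaled_pairing {K : fieldType} {U V : vectType K} (k : K)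
    (xi : 'Hom(V, K^o)) {f : U -> V} :
  linear f -> linear (fun u => k * xi (f u) : K^o).
Proof.
move=> lf c u v; rewrite lf.
have [-> _ _ ->] := scalar_linearP (dual_linear xi).
by rewrite /GRing.scale /=; ring.
Qed.

Lemma linear_pairing {K : fieldType} {U V : vectType K}
    (xi : 'Hom(V, K^o)) {f : U -> V} :
  linear f -> linear (fun u => xi (f u) : K^o).
Proof. by move=> lf c u v; rewrite lf linearP. Qed.

Lemma teval_linear {K : fieldType} {U V : vectType K}
    (xi : 'Hom(U, K^o)) (eta : 'Hom(V, K^o)) :
  linear (fun t => teval xi eta t : K^o).
Proof. exact: tform_linear. Qed.

Lemma teval_pure {K : fieldType} {U V : vectType K}
    (xi : 'Hom(U, K^o)) (eta : 'Hom(V, K^o)) u v :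
  teval xi eta (u \ox v) = xi u * eta v.
Proof.
rewrite /teval tform_pure //; split=> [w k x y|w k x y].
  have [-> _ _ ->] := scalar_linearP (dual_linear xi).
  by rewrite /GRing.scale /=; ring.
have [-> _ _ ->] := scalar_linearP (dual_linear eta).
by rewrite /GRing.scale /=; ring.
Qed.

Lemma teval_tmap {K : fieldType} {U V U' V' : vectType K}
    (xi : 'Hom(U', K^o)) (eta : 'Hom(V', K^o)) (f : U -> U') (g : V -> V') t :
  teval xi eta (tmap f g t) = tform (fun u v => (xi (f u) : K) * eta (g v)) t.
Proof.
rewrite /tmap (tform_tlift _ _ (teval_linear xi eta)).
by apply: eq_tform => u v; rewrite teval_pure.
Qed.

Definition teval3 {K : fieldType} {U V W : vectType K} (a : 'Hom(U, K^o))
    (b : 'Hom(V, K^o)) (c : 'Hom(W, K^o)) (t : tensor U (tensor V W)) : K :=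
  tform (fun u t' => (a u : K) * teval b c t') t.

Lemma teval3_linear {K : fieldType} {U V W : vectType K} (a : 'Hom(U, K^o))
    (b : 'Hom(V, K^o)) (c : 'Hom(W, K^o)) :
  linear (fun t => teval3 a b c t : K^o).
Proof. exact: tform_linear. Qed.

Lemma teval3_pure {K : fieldType} {U V W : vectType K} (a : 'Hom(U, K^o))
    (b : 'Hom(V, K^o)) (c : 'Hom(W, K^o)) u v w :
  teval3 a b c (u \ox v \ox w) = a u * (b v * c w).
Proof.
rewrite /teval3 tform_pure ?teval_pure //; split=> [t k x y|x k t t'].
  have [-> _ _ ->] := scalar_linearP (dual_linear a).
  by rewrite /GRing.scale /=; ring.
have [-> _ _ ->] := scalar_linearP (teval_linear b c).
by rewrite /GRing.scale /=; ring.
Qed.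

(** In each term two functionals meet a bare leg, one from each copy of [r], and each contracts its
    copy to [rplus] or [rminus] of itself. *)
Lemma zinbiel_bracket_pairing {K : fieldType} {A : vectType K}
    (mul : A -> A -> A) (r : tensor A A) (z x e : 'Hom(A, K^o)) :
  bilinear_map mul ->
  teval3 z x e (zinbiel_bracket mul r)
  = - z (mul (rminus r e) (rminus r x)) - x (mul (rminus r e) (rminus r z))
    + z (symprod mul (rminus r e) (rplus r x))
    + x (symprod mul (rplus r z) (rminus r e))
    - e (symprod mul (rplus r z) (rplus r x)) :> K.
Proof.
move=> bm; have [sl sr] := symprod_bilinear bm; have [bl br] := bm.
have [eD eN _ _] := scalar_linearP (teval3_linear z x e).
rewrite /zinbiel_bracket (tform_tlift _ _ (teval3_linear z x e)).
(* The inner copy of [r] is already contracted here; [a] and [b] are the legs of the outer copy. *)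
transitivity (tform (fun a b : A =>
    - ((z (mul a (rminus r x)) : K) * e b) - (x (mul a (rminus r z)) : K) * e b
    + (z (symprod mul a (rplus r x)) : K) * e b
    + (z a : K) * x (symprod mul b (rminus r e))
    - (z a : K) * e (symprod mul b (rplus r x))) r); last first.
  rewrite !tformD !tformN.
  rewrite (tform_rminus r e (linear_pairing z (bl (rminus r x)))).
  rewrite (tform_rminus r e (linear_pairing x (bl (rminus r z)))).
  rewrite (tform_rminus r e (linear_pairing z (sl (rplus r x)))).
  rewrite (tform_rplus r z (linear_pairing x (sl (rminus r e)))).
  by rewrite (tform_rplus r z (linear_pairing e (sl (rplus r x)))).
apply: eq_tform => a b.
rewrite (tform_tlift _ _ (teval3_linear z x e)).
(* Scalars are regrouped so that each term is a linear form in one inner leg times a functional of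
   the other, ready to contract. *)
transitivity (tform (fun c d : A =>
    - (((e b : K) * z (mul a c)) * x d) - ((e b : K) * x (mul a c)) * z d
    + (x c : K) * ((e b : K) * z (symprod mul a d))
    + ((z a : K) * x (symprod mul b c)) * e d
    - (x c : K) * ((z a : K) * e (symprod mul b d))) r).
  by apply: eq_tform => c d; rewrite !eD !eN !teval3_pure; ring.
rewrite !tformD !tformN.
rewrite (tform_rminus r x (linear_scaled_pairing (e b) z (br a))).
rewrite (tform_rminus r z (linear_scaled_pairing (e b) x (br a))).
rewrite (tform_rplus r x (linear_scaled_pairing (e b) z (sr a))).
rewrite (tform_rminus r e (linear_scaled_pairing (z a) x (sr b))).
rewrite (tform_rplus r x (linear_scaled_pairing (z a) e (sr b))).
by ring.
Qed.

(** Both sides are [r(xi, eta)]: [rplus r] and [rminus r] are transposes of each other. *)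
Lemma rplus_flip {K : fieldType} {A : vectType K} (r : tensor A A)
    (xi eta : 'Hom(A, K^o)) :
  eta (rplus r xi) = xi (rminus r eta).
Proof. by rewrite rplus_pairing rminus_pairing. Qed.

Lemma ImapE {K : fieldType} {A : vectType K} (r : tensor A A)
    (xi : 'Hom(A, K^o)) :
  Imap r xi = rplus r xi - rminus r xi.
Proof. by rewrite !lfunE /= !lfunE. Qed.

Lemma Imap_skew {K : fieldType} {A : vectType K} (r : tensor A A)
    (xi eta : 'Hom(A, K^o)) :
  eta (Imap r xi) = - xi (Imap r eta).
Proof. by rewrite !ImapE !linearB /= !rplus_flip opprK addrC. Qed.

Lemma teval_skew_part {K : fieldType} {A : vectType K} (r : tensor A A)
    (xi eta : 'Hom(A, K^o)) :
  teval xi eta (skew_part r) = 2^-1 * eta (Imap r xi).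
Proof.
have [tD tN _ tZ] := scalar_linearP (teval_linear xi eta).
rewrite tZ tD tN ImapE linearB /= rplus_pairing rminus_pairing.
congr (_ * (_ - _)).
rewrite /tflip (tform_tlift _ _ (teval_linear xi eta)).
by apply: eq_tform => u v; rewrite teval_pure mulrC.
Qed.

Lemma rplus_skew_part {K : fieldType} {A : vectType K} (r : tensor A A)
    (xi : 'Hom(A, K^o)) :
  rplus (skew_part r) xi = 2^-1 *: Imap r xi.
Proof.
by apply: dual_sep => eta; rewrite rplus_pairing teval_skew_part linearZ.
Qed.

Lemma rminus_skew_part {K : fieldType} {A : vectType K} (r : tensor A A)
    (xi : 'Hom(A, K^o)) :
  rminus (skew_part r) xi = - (2^-1 *: Imap r xi).
Proof.
apply: dual_sep => eta.
by rewrite rminus_pairing teval_skew_part linearN linearZ /= Imap_skew mulrN.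
Qed.

(** Invariance is evaluated at [eta], [xi]. The skew part has [I/2] and [-I/2] as its own [rplus]
    and [rminus], so both terms contract to values of [I]. *)
Lemma Imap_invariant {K : fieldType} {A : vectType K} (mul : A -> A -> A)
    (r : tensor A A) (xi eta : 'Hom(A, K^o)) x :
  2%N \notin [pchar K] -> bilinear_map mul -> LLR_invariant mul (skew_part r) ->
  eta (mul x (Imap r xi)) = - xi (symprod mul x (Imap r eta)).
Proof.
move=> charK bm inv; have bs := symprod_bilinear bm.
have n2 : 2 != 0 :> K by apply: contraNneq charK => /eqP; rewrite inE /= => ->.
have [tD tN t0 _] := scalar_linearP (teval_linear eta xi).
have /(congr1 (teval eta xi)) := inv x; rewrite tD tN t0 !teval_tmap.
rewrite (tform_rminus _ xi (linear_pairing eta (bm.2 x))).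
rewrite (tform_rplus _ eta (linear_pairing xi (bs.2 x))).
rewrite rplus_skew_part rminus_skew_part (bmulNr bm) (bmulZr bm) (bmulZr bs).
rewrite !linearN !linearZ /= scalerN -opprD => /eqP; rewrite oppr_eq0 addr_eq0.
(* The common factor [2^-1] cancels because the characteristic is not 2. *)
by move=> /eqP E; apply: (mulfI (invr_neq0 n2)); rewrite mulrN; exact: E.
Qed.

Lemma rproductE {K : fieldType} {A : vectType K} (mul : A -> A -> A)
    (r : tensor A A) (xi eta : 'Hom(A, K^o)) x :
  bilinear_map mul ->
  rproduct mul r xi eta x
  = eta (symprod mul (rplus r xi) x) - xi (mul x (rminus r eta)).
Proof.
move=> bm; rewrite /rproduct add_lfunE opp_lfunE add_lfunE LstarE // !RstarE //.
by rewrite opprD !opprK -linearD.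
Qed.

(** Invariance for [(xi, eta)] and for [(eta, xi)] are combined; the terms with [x] on the left
    cancel. *)
Lemma Imap_invariant_right {K : fieldType} {A : vectType K} (mul : A -> A -> A)
    (r : tensor A A) (xi eta : 'Hom(A, K^o)) x :
  2%N \notin [pchar K] -> bilinear_map mul -> LLR_invariant mul (skew_part r) ->
  eta (mul (Imap r xi) x) = xi (mul (Imap r eta) x).
Proof.
move=> charK bm inv.
have := Imap_invariant mul r xi eta x charK bm inv.
have := Imap_invariant mul r eta xi x charK bm inv.
rewrite /symprod !linearD /= => ->.
rewrite opprD opprK -addrA -[X in X = _]addr0 => /addrI/esym/eqP.
by rewrite opprK subr_eq0 => /eqP.
Qed.

(** Skewness moves [I] onto the test functional [z]; the two forms of invariance then bring it back,
    one for each term of the product. *)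
Lemma Imap_rproduct {K : fieldType} {A : vectType K} (mul : A -> A -> A)
    (r : tensor A A) (xi eta : 'Hom(A, K^o)) :
  2%N \notin [pchar K] -> quasi_triangular mul r ->
  Imap r (rproduct mul r xi eta)
  = mul (rplus r xi) (Imap r eta) + mul (Imap r xi) (rminus r eta).
Proof.
move=> charK [[bm _] _ inv]; apply: dual_sep => z.
rewrite Imap_skew rproductE // [RHS]linearD /= (Imap_invariant mul) //.
by rewrite (Imap_invariant_right mul) // opprB addrC.
Qed.

(** Paired with [z], the left side is the product [xi . eta] at [r_+ z]. The bracket at
    [(z, xi, eta)] computes it up to [xi (r_- eta o I z) + z (r_- eta * I xi)], which vanishes by
    invariance. *)
Lemma rminus_rproduct {K : fieldType} {A : vectType K} (mul : A -> A -> A)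
    (r : tensor A A) (xi eta : 'Hom(A, K^o)) :
  2%N \notin [pchar K] -> quasi_triangular mul r ->
  rminus r (rproduct mul r xi eta) = mul (rminus r xi) (rminus r eta).
Proof.
move=> charK [[bm _] br inv]; apply: dual_sep => z.
have [_ _ t0 _] := scalar_linearP (teval3_linear z xi eta).
have /esym := zinbiel_bracket_pairing mul r z xi eta bm; rewrite br t0.
have := Imap_invariant mul r z xi (rminus r eta) charK bm inv.
rewrite -rplus_flip rproductE // !ImapE /symprod.
rewrite !(bmulDr bm, bmulDl bm, bmulNr bm, bmulNl bm) !linearD !linearN /=.
exact: arith1.
Qed.

Theorem theorem5p6 (K : fieldType) (charK : 2%N \notin [pchar K])
    (A : vectType K) (mul : A -> A -> A) (r : tensor A A)
    (factr : factorizable mul r) (lambda : K) :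
  quadratic_rota_baxter_zinbiel mul lambda
    (lambda *: (rminus r \o (Imap r)^-1)%VF) (omegaI r).
Proof.
have [qt [J IK JK]] := factr; have [[bm _] _ inv] := qt.
(* [^-1] is total on linear maps; a zero kernel makes it a genuine left inverse. *)
have kerI : lker (Imap r) == 0%VS by apply/lker0P; exact: can_inj IK.
have sur x : exists xi, x = Imap r xi by exists (J x).
have omegaE xi y : omegaI r (Imap r xi) y = xi y.
  by rewrite /omegaI lker0_lfunK.
have PE xi : (lambda *: (rminus r \o (Imap r)^-1)%VF) (Imap r xi)
    = lambda *: rminus r xi.
  by rewrite scale_lfunE comp_lfunE lker0_lfunK.
split.
- exact: quasi_triangular_zinbiel qt.
- move=> x y; have [xi ->] := sur x; have [eta ->] := sur y.
  rewrite !PE !(bmulZl bm, bmulZr bm) -!scalerDr.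
  (* One [lambda] has been pulled out of the argument of [P]. The first and third terms merge
     through [r_- + I = r_+]. *)
  have -> : mul (rminus r xi) (Imap r eta) + mul (Imap r xi) (rminus r eta)
      + mul (Imap r xi) (Imap r eta) = Imap r (rproduct mul r xi eta).
    rewrite Imap_rproduct // addrAC -(bmulDl bm).
    by rewrite [Imap r xi in X in mul X]ImapE [rminus _ _ + _]addrC subrK.
  rewrite -[_ *: Imap r _]linearZ PE [rminus r (_ *: _)]linearZ /=.
  by rewrite rminus_rproduct.
- split=> [y k u v|x]; last exact: lfun_linear.
  by rewrite /omegaI linearP /= add_lfunE scale_lfunE.
- move=> x y; have [xi ->] := sur x; have [eta ->] := sur y.
  by rewrite !omegaE Imap_skew.
- move=> x; have [xi ->] := sur x => xi0.
  suff -> : xi = 0 by rewrite linear0.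
  by apply/lfunP=> y; rewrite -omegaE xi0 lfunE.
- move=> x y z; have [xi ->] := sur y; have [eta ->] := sur z.
  (* Any preimage [zeta] will do: skewness replaces [zeta (I eta)] by [- eta (I zeta)], whose
     argument is the given product. *)
  have [zeta E] := sur (mul x (Imap r xi)).
  by rewrite omegaE E omegaE Imap_skew -E (Imap_invariant mul) // opprK.
- move=> x y; have [xi ->] := sur x; have [eta ->] := sur y.
  (* Up to [lambda], the summands are [- eta (r_- xi)], [xi (r_- eta)] and
     [xi (I eta) = eta (r_- xi) - xi (r_- eta)]. *)
  have [zeta E] := sur (rminus r xi).
  rewrite !PE !omegaE E -linearZ omegaE.
  rewrite scale_lfunE linearZ /= Imap_skew -E ImapE linearB /= rplus_flip.
  by rewrite /GRing.scale /=; ring.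
Qed.
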